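(* No randomized online algorithm for the Online Multi-Commodity Facility Location Problem with commodity set $S$ and $n$ requests can achieve a competitive ratio better than $\Omega\left(\sqrt{|S|}+\frac{\log n}{\log\log n}\right)$, even on line metrics. That is, there is an absolute constant $\kappa>0$ such that for every finite commodity set $S$ and every randomized online algorithm that is $c(|S|,n)$-competitive on instances with commodity set $S$ whose metric space is a finite subset of the real line, one has $c(|S|,n)\ge \kappa\left(\sqrt{|S|}+\frac{\log n}{\log\log n}\right)$ for all sufficiently large $n$.
   Context: Online Multi-Commodity Facility Location Problem (OMFLP). An instance consists of a finite metric space with point set $M$ and distance $d$, a finite nonempty set $S$ of commodities, construction costs $f_m^\sigma\ge 0$ for all $m\in M$ and $\sigma\subseteq S$ (all known in advance), and a sequence of $n$ requests. Each request $r$ is located at a point of $M$ and demands a nonempty set $s_r\subseteq S$; $d(m,r)$ denotes the distance from $m\in M$ to the location of $r$. A solution opens facilities, each at a point $m\in M$ with a configuration $\sigma\subseteq S$ (the set of commodities it offers), at cost $f_m^\sigma$; several facilities may be opened at the same point. Each request $r$ is assigned to a set of open facilities that jointly offer all commodities of $s_r$, at assignment cost equal to the sum of the distances from $r$ to these facilities. The total cost is the sum of all construction and assignment costs. Requests are revealed one by one; on arrival a request must immediately be assigned, where the algorithm may first open new facilities; all decisions are irrevocable. Standing assumptions on the costs: subadditivity, $f_m^{a\cup b}\le f_m^a+f_m^b$ for all $m\in M$, $a,b\subseteq S$; and $f_m^\sigma/|\sigma|\ge f_m^S/|S|$ for all $m\in M$ and nonempty $\sigma\subseteq S$. Competitive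 ratio: a (randomized) online algorithm is $c(|S|,n)$-competitive if there is a constant $a$, independent of the instance, such that on every instance its (expected) cost is at most $c(|S|,n)\cdot \mathrm{OPT}+a$, where OPT is the optimal offline cost of the instance and $n$ its number of requests. *)

(* Defs.v *)
From mathcomp Require Import all_boot all_order all_algebra finmap.
From mathcomp Require Import all_classical all_reals all_analysis.

Set Implicit Arguments.
Unset Strict Implicit.
Unset Printing Implicit Defensive.

Import Order.TTheory GRing.Theory Num.Theory.

Local Open Scope ring_scope.

(* The part of an instance that is known in advance. *)
Record setting (R : realType) (S : finType) := Setting {
  point :> finType;
  dist : point -> point -> R;
  cost : point -> {set S} -> R;
  dist_ge0 : forall x y, 0 <= dist x y;
  dist_eq0 : forall x y, dist x y = 0 <-> x = y;
  dist_sym : forall x y, dist x y = dist y x;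
  dist_triangle : forall x y z, dist x z <= dist x y + dist y z;
  cost_ge0 : forall m s, 0 <= cost m s;
  cost_subadditive : forall m a b, cost m (a :|: b)%SET <= cost m a + cost m b;
  cost_per_commodity : forall m s, s != finset.set0 ->
    cost m [set: S]%SET / #|S|%:R <= cost m s / #|s|%:R
}.

(* The points can be identified with a finite set of reals: by [dist_eq0] the
   map p is automatically injective. *)
Definition line_metric (R : realType) (S : finType) (E : setting R S) : Prop :=
  exists p : E -> R, forall x y, dist x y = `|p x - p y|.

Record request (R : realType) (S : finType) (E : setting R S) := Request {
  loc : E;
  demand : {set S};
  demand_neq0 : demand != finset.set0
}.

Definition facility (R : realType) (S : finType) (E : setting R S) : Type :=
  (E * {set S})%type.

(* Facilities are listed with multiplicity and designated by their position in
   the list, so that identical facilities remain distinct. The i-th assignment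
   is the set of positions of the facilities serving the i-th request. *)
Record solution (R : realType) (S : finType) (E : setting R S) := Solution {
  facilities : seq (facility E);
  assignments : seq {fset nat}
}.

(* The default value is never used when j < size F. *)
Definition nth_facility (R : realType) (S : finType) (E : setting R S)
    (F : seq (facility E)) (r : request E) (j : nat) : facility E :=
  nth (loc r, finset.set0) F j.

Definition serves (R : realType) (S : finType) (E : setting R S)
    (F : seq (facility E)) (r : request E) (A : {fset nat}) : bool :=
  all (fun j => (j < size F)%N) A &&
  (demand r \subset (\bigcup_(j <- A) (nth_facility F r j).2)%SET).

Definition assignment_cost (R : realType) (S : finType) (E : setting R S)
    (F : seq (facility E)) (r : request E) (A : {fset nat}) : R :=
  \sum_(j <- A) dist (nth_facility F r j).1 (loc r).

(* [all2] also forces exactly one assignment per request. *)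
Definition feasible (R : realType) (S : finType) (E : setting R S)
    (rs : seq (request E)) (sol : solution E) : bool :=
  all2 (serves (facilities sol)) rs (assignments sol).

Definition total_cost (R : realType) (S : finType) (E : setting R S)
    (rs : seq (request E)) (sol : solution E) : R :=
  \sum_(f <- facilities sol) cost f.1 f.2 +
  \sum_(rA <- zip rs (assignments sol))
     assignment_cost (facilities sol) rA.1 rA.2.

(* The set is nonempty (open the configuration S everywhere) and bounded below
   by 0. *)
Definition opt (R : realType) (S : finType) (E : setting R S)
    (rs : seq (request E)) : R :=
  inf [set total_cost rs sol | sol in [set sol | feasible rs sol]]%classic.

(* The reaction to one request: the facilities newly opened, and the set of
   facilities it is assigned to; positions refer to the list of all facilities
   opened so far, in order of opening. *)
Definition decision (R : realType) (S : finType) (E : setting R S) : Type :=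
  (seq (facility E) * {fset nat})%type.

(* [A past r] is the reaction to r after the requests in past; [run A past rs]
   lists the reactions to rs arriving after past. *)
Fixpoint run (R : realType) (S : finType) (E : setting R S)
    (A : seq (request E) -> request E -> decision E)
    (past rs : seq (request E)) : seq (decision E) :=
  if rs is r :: rs' then A past r :: run A (rcons past r) rs' else [::].

Definition online_solution (R : realType) (S : finType) (E : setting R S)
    (A : seq (request E) -> request E -> decision E)
    (rs : seq (request E)) : solution E :=
  let ds := run A [::] rs in Solution (flatten (unzip1 ds)) (unzip2 ds).

(* The number of requests is not revealed to the algorithm. *)
Record online_algorithm (R : realType) (S : finType) := OnlineAlgorithm {
  decide : forall E : setting R S,
    seq (request E) -> request E -> decision E;
  decide_serves : forall (E : setting R S) (past : seq (request E)) (r : request E),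
    serves (facilities (online_solution (@decide E) (rcons past r)))
           r (decide past r).2
}.

(* A probability distribution over deterministic online algorithms. The
   decisions form a countable set, so that measurability amounts to the
   measurability of each event "this decision is taken". *)
Record randomized_algorithm (R : realType) (S : finType) := RandomizedAlgorithm {
  sample_display : measure_display;
  sample : measurableType sample_display;
  sample_prob : probability sample R;
  realization : sample -> online_algorithm R S;
  measurable_decide : forall (E : setting R S) (past : seq (request E))
      (r : request E) (x : decision E),
    measurable [set w | decide (realization w) past r = x]%classic
}.

Definition expected_cost (R : realType) (S : finType)
    (A : randomized_algorithm R S) (E : setting R S) (rs : seq (request E)) : \bar R :=
  expectation (sample_prob A)
    (fun w => total_cost rs (online_solution (@decide R S (realization w) E) rs)).

(* c-competitiveness on the instances with commodity set S whose setting
   satisfies Q. *)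
Definition competitive (R : realType) (S : finType) (Q : setting R S -> Prop)
    (A : randomized_algorithm R S) (c : nat -> nat -> R) : Prop :=
  exists a : R, forall E : setting R S, Q E -> forall rs : seq (request E),
    (expected_cost A rs <= (c #|S| (size rs) * opt rs + a)%:E)%E.

(* Main.v *)
(** Both summands come from averaging over a random request sequence (Yao's
    principle); since the additive constant does not depend on the instance,
    multiplying all costs and distances by a large factor removes it.

    For the square root, take one point, opening cost [1 + |s| / k] with
    [k ^ 2 <= |S|], and request [k] uniformly random commodities. A facility
    opened in advance for [s] answers on average at most [k |s| / |S| <= |s| / k]
    requests, and every unanswered request opens a facility, so the algorithm
    pays at least [k] on average, while one facility of cost at most 2 suffices.

    For the logarithm, descend to a random leaf of the binary tree of depth [h]
    whose edges shrink by a factor [m = h + 1] per level, embedded in the line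
    by base [m] expansions, with opening cost 1 and [m ^ t] requests at the node
    of level [t]. If no facility lies below that node, these requests cost at
    least 1/2. A facility opened before the next turn is known stays below the
    current node with probability halved at each level, hence spares only a
    bounded expected number of levels. The algorithm pays at least [h / 2] and a
    facility at the leaf costs at most 2 altogether. As [m ^ h <= n] is allowed,
    [h] can be of order [ln n / ln (ln n)]. *)

Require Import Defs.
From mathcomp Require Import all_boot all_order all_algebra finmap.
From mathcomp Require Import all_classical all_reals all_analysis.
From mathcomp Require Import ring lra zify.

Import Order.TTheory GRing.Theory Num.Theory.

Local Open Scope ring_scope.

Set Implicit Arguments.
Unset Strict Implicit.
Unset Printing Implicit Defensive.

(** * Costs of solutions and the effect of further facilities *)

Section Online.

Context {R : realType} {S : finType} {E : setting R S}.
Implicit Types (F : seq (facility E)) (r : request E) (rs past : seq (request E)).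

Lemma total_cost_ge0 rs (sol : solution E) : 0 <= total_cost rs sol.
Proof.
apply: addr_ge0; apply: sumr_ge0 => i _; first exact: cost_ge0.
by apply: sumr_ge0 => j _; apply: dist_ge0.
Qed.

Lemma opt_le rs (sol : solution E) :
  feasible rs sol -> opt rs <= total_cost rs sol.
Proof.
move=> fs; apply: ge_inf; last by exists sol.
by exists 0 => _ [s _ <-]; exact: total_cost_ge0.
Qed.

(** A nonempty demand forces [B] to contain a facility, which alone costs at least [delta]. *)
Lemma assignment_cost_ge F r (B : {fset nat}) (delta : R) :
  serves F r B -> (forall f, f \in F -> delta <= dist f.1 (loc r)) ->
  delta <= assignment_cost F r B.
Proof.
case/andP => /allP Bsz Bdem Fd.
have /finset.set0Pn[s sr] := demand_neq0 r.
rewrite /assignment_cost.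
have [B0|[j jB]] := fset_0Vmem B.
  by move: (fintype.subsetP Bdem _ sr); rewrite B0 big_seq_fset0 inE.
rewrite (big_rem j)//=; apply: ler_wpDr.
  by apply: sumr_ge0 => i _; apply: dist_ge0.
by apply: Fd; apply: mem_nth; apply: Bsz.
Qed.

Lemma assignment_cost_cat F F' r (B : {fset nat}) :
  serves F r B -> assignment_cost (F ++ F') r B = assignment_cost F r B.
Proof.
case/andP => /allP Bsz _; apply: eq_big_seq => j /Bsz jF.
by rewrite /nth_facility nth_cat jF.
Qed.

Lemma serves_cat F F' r (B : {fset nat}) : serves F r B -> serves (F ++ F') r B.
Proof.
case/andP => /allP Bsz Bdem; apply/andP; split.
  by apply/allP => j /Bsz jF; rewrite size_cat ltn_addr.
rewrite (_ : \bigcup_(j <- B) _ = \bigcup_(j <- B) (nth_facility F r j).2)%SET//.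
by apply: eq_big_seq => j /Bsz jF; rewrite /nth_facility nth_cat jF.
Qed.

Lemma run_rcons (A : seq (request E) -> request E -> decision E) past rs r :
  run A past (rcons rs r) = rcons (run A past rs) (A (past ++ rs) r).
Proof.
elim: rs past => [|q rs IH] past /=; first by rewrite cats0.
by rewrite IH cat_rcons.
Qed.

Lemma size_run (A : seq (request E) -> request E -> decision E) past rs :
  size (run A past rs) = size rs.
Proof. by elim: rs past => //= r rs IH past; rewrite IH. Qed.

End Online.

(** * Runs of a deterministic online algorithm *)

Section Deterministic.

Context {R : realType} {S : finType} {E : setting R S}.
Variable D : online_algorithm R S.
Implicit Types (r : request E) (rs : seq (request E)).

Definition opened rs : seq (facility E) :=
  facilities (online_solution (@decide R S D E) rs).

Definition online_cost rs : R :=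
  total_cost rs (online_solution (@decide R S D E) rs).

Lemma opened_rcons rs r : opened (rcons rs r) = opened rs ++ (decide D rs r).1.
Proof.
rewrite /opened /online_solution /= run_rcons /unzip1 map_rcons flatten_rcons.
by [].
Qed.

Lemma opened_cat rs rs' : exists F, opened (rs ++ rs') = opened rs ++ F.
Proof.
elim/last_ind: rs' => [|rs' r [F IH]]; first by exists [::]; rewrite !cats0.
by exists (F ++ (decide D (rs ++ rs') r).1); rewrite -rcons_cat opened_rcons IH catA.
Qed.

Lemma online_feasible rs :
  feasible rs (online_solution (@decide R S D E) rs).
Proof.
elim/last_ind: rs => // rs r IH.
rewrite /feasible -/(opened _) /= run_rcons /= /unzip2 map_rcons.
have sz : size rs == size [seq p.2 | p <- run (decide D (E:=E)) [::] rs].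
  by rewrite size_map size_run.
rewrite all2E !size_rcons eqSS sz/= zip_rcons; last exact/eqP.
rewrite all_rcons; apply/andP; split; first exact: decide_serves.
move: IH; rewrite /feasible all2E sz /=.
apply: sub_all => -[q B] /= qB; rewrite opened_rcons; exact: serves_cat.
Qed.

(** Earlier assignments only name positions already occupied, so the facilities opened for [r] leave
    their costs unchanged. *)
Lemma online_cost_rcons rs r :
  online_cost (rcons rs r) = online_cost rs
    + \sum_(f <- (decide D rs r).1) cost f.1 f.2
    + assignment_cost (opened (rcons rs r)) r (decide D rs r).2.
Proof.
rewrite /online_cost /total_cost -!/(opened _) {1}opened_rcons big_cat /=.
rewrite run_rcons /= /unzip2 map_rcons -/(unzip2 _).
rewrite zip_rcons; last by rewrite size_map size_run.
rewrite -cats1 big_cat big_seq1 /=.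
rewrite [in LHS](_ : \sum_(i <- _) assignment_cost _ _ _ =
  \sum_(rA <- zip rs (unzip2 (run (decide D (E:=E)) [::] rs)))
     assignment_cost (opened rs) rA.1 rA.2); first by ring.
have := online_feasible rs; rewrite /feasible all2E => /andP[_].
rewrite -/(opened _) opened_rcons /=.
elim: (zip _ _) => [|[q B] s IH]; first by rewrite !big_nil.
by case/andP => qB /IH {}IH; rewrite !big_cons IH assignment_cost_cat.
Qed.

Lemma online_cost_le_cat rs rs' : online_cost rs <= online_cost (rs ++ rs').
Proof.
elim/last_ind: rs' => [|rs' r IH]; first by rewrite cats0.
rewrite -rcons_cat online_cost_rcons -addrA; apply: (le_trans IH).
rewrite lerDl addr_ge0//; apply: sumr_ge0 => i _; first exact: cost_ge0.
exact: dist_ge0.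
Qed.

Lemma online_cost_ge_opened rs :
  \sum_(f <- opened rs) cost f.1 f.2 <= online_cost rs.
Proof.
rewrite lerDl; apply: sumr_ge0 => i _; apply: sumr_ge0 => j _; exact: dist_ge0.
Qed.

(** The distance bound is imposed on the facilities open at the end, hence holds at each of the [q]
    arrivals, all of which pay [delta] on top of construction. *)
Lemma online_cost_nseq rs q r (delta : R) : 0 <= delta ->
  (forall f, f \in opened (rs ++ nseq q r) -> delta <= dist f.1 (loc r)) ->
  online_cost rs + \sum_(f <- opened (rs ++ nseq q r)) cost f.1 f.2
    - \sum_(f <- opened rs) cost f.1 f.2 + delta *+ q
  <= online_cost (rs ++ nseq q r).
Proof.
move=> d0; elim: q => [|q IH] far; first by rewrite cats0; lra.
have nE : rs ++ nseq q.+1 r = rcons (rs ++ nseq q r) r.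
  by rewrite -[q.+1]addn1 nseqD catA cats1.
move: far; rewrite {}nE => far.
have {}IH := IH _; rewrite online_cost_rcons.
have /IH : forall f, f \in opened (rs ++ nseq q r) -> delta <= dist f.1 (loc r).
  by move=> f fF; apply: far; rewrite opened_rcons mem_cat fF.
have := assignment_cost_ge (decide_serves D (rs ++ nseq q r) r) far.
rewrite -/(opened _) opened_rcons big_cat /= mulrS.
by rewrite -opened_rcons; lra.
Qed.

Lemma online_cost_cat rs rs' :
  online_cost rs + \sum_(f <- opened (rs ++ rs')) cost f.1 f.2
    - \sum_(f <- opened rs) cost f.1 f.2 <= online_cost (rs ++ rs').
Proof.
elim/last_ind: rs' => [|rs' r IH]; first by rewrite cats0; lra.
rewrite -rcons_cat online_cost_rcons opened_rcons big_cat /=.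
have : 0 <= assignment_cost (opened (rs ++ rs') ++ (decide D (rs ++ rs') r).1)
              r (decide D (rs ++ rs') r).2.
  by apply: sumr_ge0 => i _; apply: dist_ge0.
lra.
Qed.

Lemma opened_serves rs r s : s \in demand r ->
  has (fun f : facility E => s \in f.2) (opened (rcons rs r)).
Proof.
move=> sr; have /andP[/allP Bsz /fintype.subsetP/(_ _ sr)] := decide_serves D rs r.
rewrite big_seq_cond; elim/big_ind: _ => [|X Y HX HY|j]; first by rewrite inE.
  by rewrite inE => /orP[/HX|/HY].
rewrite andbT => jB sj; apply/hasP.
by exists (nth_facility (opened (rcons rs r)) r j) => //; apply/mem_nth/Bsz.
Qed.

End Deterministic.

(** * Measurability of the online cost and Yao's principle *)

Lemma measurable_countable_comp (d : measure_display) (T : measurableType d)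
    (R : realType) (C : countType) (f : T -> C) (g : C -> R) :
  (forall c, measurable [set t | f t = c]%classic) ->
  measurable_fun [set: T]%classic (fun t => g (f t)).
Proof.
move=> mf _ B _; rewrite setTI.
(* As [f] takes countably many values, the preimage is a countable union of measurable fibres. *)
rewrite (_ : _ @^-1` _ = \bigcup_(c : C)
   (if `[< B (g c) >] then [set t | f t = c] else set0))%classic; last first.
  apply/seteqP; split => t /=.
    by move=> Bt; exists (f t) => //; rewrite asboolT.
  by case=> c _; case: asboolP => // Bc /= ->.
apply: countable_bigcupT_measurable => // c; case: ifP => // _; exact: mf.
Qed.

Section Randomized.

Context {R : realType} {S : finType} (A : randomized_algorithm R S).
Context {E : setting R S}.
Implicit Types (past rs : seq (request E)).

Lemma measurable_run past rs (ds : seq (decision E)) :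
  measurable [set w : sample A | run (@decide R S (realization w) E) past rs = ds]%classic.
Proof.
elim: rs past ds => [|r rs IH] past ds /=.
  by case: ds => [|d ds]; [rewrite (_ : mkset _ = setT)|rewrite (_ : mkset _ = set0)];
    rewrite //; apply/seteqP; split.
case: ds => [|d ds]; first by rewrite (_ : mkset _ = set0)//; apply/seteqP; split.
rewrite (_ : mkset _ = [set w | decide (realization w) past r = d] `&`
  [set w | run (decide (realization w) (E:=E)) (rcons past r) rs = ds])%classic.
  by apply: measurableI; [exact: measurable_decide | exact: IH].
by apply/seteqP; split => w /=; [case|case=> -> ->].
Qed.

Lemma measurable_online_cost rs :
  measurable_fun [set: sample A]%classic (fun w => @online_cost R S E (realization w) rs).
Proof.
apply: (@measurable_countable_comp _ _ _ (seq (seq (E * {set S}) * {fset nat}))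
  (fun w => run (@decide R S (realization w) E) [::] rs)
  (fun ds => total_cost rs (Solution (flatten (unzip1 ds)) (unzip2 ds)))).
by move=> ds; exact: measurable_run.
Qed.

Lemma sum_expected_cost_ge (I : finType) (rs : I -> seq (request E)) (b : R) :
  (forall D : online_algorithm R S, b <= \sum_i online_cost D (rs i)) ->
  (b%:E <= \sum_i expected_cost A (rs i))%E.
Proof.
move=> bD; rewrite (eq_bigr (fun i =>
    \int[sample_prob A]_w (online_cost (realization w) (rs i))%:E)%E); last first.
  by move=> i _; rewrite /expected_cost unlock.
rewrite -(@ge0_integral_sum _ _ _ (sample_prob A) _ measurableT _
  (fun i w => (online_cost (realization w) (rs i))%:E)).
(* The comparison of integrals below is for nonnegative functions, so [b <= 0] is treated apart. *)
- have [b0|b0] := leP b 0.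
    apply: (@le_trans _ _ 0%E); first by rewrite lee_fin.
    apply: integral_ge0 => w _; rewrite sumEFin lee_fin.
    by apply: sumr_ge0 => i _; apply: total_cost_ge0.
  rewrite -[leLHS]mule1 -(probability_setT (sample_prob A)) -integral_cst//.
  apply: ge0_le_integral => //.
  + by move=> w _; rewrite lee_fin ltW.
  + apply: emeasurable_sum => i.
    by apply/measurable_realfun.measurable_EFinP; exact: measurable_online_cost.
  + by move=> w _; rewrite sumEFin lee_fin.
- by move=> i; apply/measurable_realfun.measurable_EFinP; exact: measurable_online_cost.
- by move=> i w _; rewrite lee_fin; exact: total_cost_ge0.
Qed.

(** Averaged over [I], the cost is at least [lb] for every realization, hence in expectation, while
    competitiveness bounds each term from above. Using [Num.max C 0] allows replacing [opt] by [ub]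
    whatever the sign of [C]. *)
Lemma yao_bound (I : finType) (rs : I -> seq (request E)) (n : nat) (C a lb ub : R) :
  (0 < #|I|)%N ->
  (forall i, size (rs i) = n) -> (forall i, opt (rs i) <= ub) ->
  (forall i, 0 <= opt (rs i)) ->
  (forall D : online_algorithm R S, lb *+ #|I| <= \sum_i online_cost D (rs i)) ->
  (forall i, expected_cost A (rs i) <= (C * opt (rs i) + a)%:E)%E ->
  lb <= Num.max C 0 * ub + a.
Proof.
move=> I0 sz oub o0 lbD comp.
have := sum_expected_cost_ge lbD.
have : (\sum_i expected_cost A (rs i) <=
        \sum_(i in I) (Num.max C 0 * ub + a)%:E)%E.
  apply: lee_sum => i _; apply: (le_trans (comp i)); rewrite lee_fin lerD2r.
  case: (leP C 0) => C0; first by rewrite mul0r mulr_le0_ge0.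
  by rewrite ler_wpM2l// ltW.
move=> h1 h2; have := le_trans h2 h1; rewrite sumEFin lee_fin sumr_const.
by rewrite lerMn2r => /orP[/eqP I00|//]; rewrite I00 in I0.
Qed.

End Randomized.

(** * Bounds on the optimum, resampling and scaling *)

Lemma opt_le_single (R : realType) (S : finType) (E : setting R S)
    (f : facility E) (rs : seq (request E)) :
  all (fun r => demand r \subset f.2) rs ->
  opt rs <= cost f.1 f.2 + \sum_(r <- rs) dist f.1 (loc r).
Proof.
move=> demf; pose sol := Solution [:: f] (nseq (size rs) [fset 0%N]%fset).
have -> : cost f.1 f.2 + \sum_(r <- rs) dist f.1 (loc r) = total_cost rs sol.
  rewrite /total_cost /= big_seq1; congr (_ + _).
  elim: rs {demf sol} => [|r rs IH]; first by rewrite !big_nil.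
  by rewrite /= !big_cons IH /= /assignment_cost big_seq_fset1.
apply: opt_le; rewrite /feasible /=.
elim: rs demf {sol} => //= r rs IH /andP[rf /IH ->]; rewrite andbT /serves.
by rewrite big_seq_fset1 /= rf andbT; apply/allP => j; rewrite inE => /eqP ->.
Qed.

Lemma opt_ge0 (R : realType) (S : finType) (E : setting R S)
    (rs : seq (request E)) : 0 <= opt rs.
Proof.
have [[y sy]|no] := pselect ([set total_cost rs sol | sol in
    [set sol : solution E | feasible rs sol]] !=set0)%classic; last first.
  (* The infimum of the empty set is 0 by convention. *)
  by rewrite /opt inf_out// => -[].
by apply: lb_le_inf; [exists y|move=> _ [s _ <-]; exact: total_cost_ge0].
Qed.

Definition resample (h : nat) (X : finType) (x : {ffun 'I_h -> X}) (t : 'I_h)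
  (a : X) : {ffun 'I_h -> X} := [ffun j => if j == t then a else x j].

(** Exchanging coordinate [t] with the fresh value is an involution on pairs, so resampling one
    coordinate of a uniform [x] preserves averages. *)
Lemma sum_resample (h : nat) (X : finType) (t : 'I_h)
    (phi : {ffun 'I_h -> X} -> nat) :
  (\sum_x \sum_a phi (resample x t a) = (\sum_x phi x) * #|X|)%N.
Proof.
rewrite pair_bigA /=.
pose swap (p : {ffun 'I_h -> X} * X) := (resample p.1 t p.2, p.1 t).
have swapK : involutive swap.
  case=> x a; rewrite /swap /=; congr pair; last by rewrite ffunE eqxx.
  by apply/ffunP => j; rewrite !ffunE; case: eqP => [->|].
rewrite (reindex_inj (inv_inj swapK)) /=.
under eq_bigr => p _ do rewrite -[resample _ _ _]/((swap (swap p)).1) swapK.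
rewrite -(pair_bigA _ (fun x _ => phi x)) /= big_distrl.
by apply: eq_bigr => x _; rewrite sum_nat_const mulnC.
Qed.

Lemma scaling_bound (R : realType) (b u M a : R) :
  (forall L, 0 < L -> L * b <= M * (L * u) + a) -> b <= M * u.
Proof.
move=> H; rewrite leNgt; apply/negP => bu.
have e0 : 0 < b - M * u by rewrite subr_gt0.
(* For this [L], the gap [L * (b - M * u)] equals [|a| + 1] and exceeds [a]. *)
have := H ((`|a| + 1) / (b - M * u)) (divr_gt0 (ltr_wpDl (normr_ge0 a) ltr01) e0).
rewrite mulrCA -lerBlDl -mulrBr divfK ?gt_eqF// => le_a.
by have := ler_norm a; lra.
Qed.

(** * The square root: random commodities at a single point *)

Section SinglePoint.

Context {R : realType} {S : finType}.
Variables (k : nat) (L : R).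
Hypotheses (L0 : 0 < L) (kS : (k.+1 ^ 2 <= #|S|)%N).

(** The number of random commodities is [k.+1]; [L] is the scale that later absorbs the additive
    constant. *)
Definition point_cost (_ : unit) (s : {set S}) : R :=
  L * (1 + #|s|%:R / k.+1%:R).

Lemma point_cost_ge0 m s : 0 <= point_cost m s.
Proof. by rewrite mulr_ge0 ?(ltW L0)// addr_ge0// divr_ge0. Qed.

Lemma point_cost_subadditive m a b :
  point_cost m (a :|: b)%SET <= point_cost m a + point_cost m b.
Proof.
rewrite /point_cost -mulrDr ler_pM2l// addrACA -mulrDl lerD ?lerDl//.
by rewrite ler_wpM2r// -natrD ler_nat cardsU leq_subr.
Qed.

Lemma point_cost_per_commodity m (s : {set S}) : s != finset.set0 ->
  point_cost m [set: S]%SET / #|S|%:R <= point_cost m s / #|s|%:R.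
Proof.
rewrite -card_gt0 => s0; have S0 := leq_trans s0 (max_card _).
rewrite /point_cost cardsT -!mulrA ler_pM2l//.
(* Per commodity the cost is [L * (1 / |s| + 1 / k.+1)], which decreases in [|s|]. *)
have E (n : nat) : (0 < n)%N -> (1 + n%:R / k.+1%:R) / n%:R = n%:R^-1 + k.+1%:R^-1 :> R.
  by move=> n0; rewrite mulrDl mul1r mulrAC divff ?mul1r// pnatr_eq0 -lt0n.
rewrite !E// lerD2r.
by rewrite lef_pV2 ?posrE ?ltr0n// ler_nat max_card.
Qed.

Definition single_point : setting R S :=
  @Setting R S unit (fun _ _ => 0) point_cost (fun _ _ => lexx 0)
    (fun 'tt 'tt => conj (fun=> erefl) (fun=> erefl)) (fun _ _ => erefl)
    (fun _ _ _ => eq_ind_r (fun z => 0 <= z) (lexx 0) (addr0 0))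
    point_cost_ge0 point_cost_subadditive point_cost_per_commodity.

Lemma single_point_line : line_metric single_point.
Proof. by exists (fun=> 0) => x y; rewrite subrr normr0. Qed.

Lemma singleton_neq0 (s : S) : [set s]%SET != finset.set0.
Proof. by rewrite -card_gt0 cards1. Qed.

Definition singleton_request (s : S) : request single_point :=
  @Request R S single_point tt [set s]%SET (singleton_neq0 s).

Let X := {ffun 'I_k.+1 -> S}.
Let req (x : X) (i : nat) := singleton_request (x (inord i)).

(* The repetitions of the first request only bring the length to [n]. *)
Definition commodity_requests (n : nat) (x : X) :=
  mkseq (req x) k.+1 ++ nseq (n - k.+1) (req x 0).

Lemma opt_commodity_requests n x : opt (commodity_requests n x) <= L * 2.
Proof.
(* One facility offering exactly the requested commodities, at most [k.+1] of them. *)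
pose s := [set x i | i : 'I_k.+1]%SET.
apply: (le_trans (@opt_le_single _ _ single_point (tt, s) _ _)).
  rewrite all_cat all_nseq; apply/andP; split.
    rewrite /mkseq all_map; apply/allP => i _ /=.
    by rewrite finset.sub1set; apply: imset_f.
  by rewrite /= finset.sub1set imset_f ?orbT.
rewrite big1// addr0 ler_pM2l// (_ : 2 = 1 + 1)// lerD2l.
rewrite ler_pdivrMr ?ltr0n// mul1r ler_nat.
by apply: (leq_trans (leq_imset_card _ _)); rewrite card_ord.
Qed.

Variable D : online_algorithm R S.

(** Requests are numbered from 0, so [G t x] is the stock on arrival of request [t], and [hits]
    refers to facilities opened in advance. *)
Let G (t : nat) (x : X) := opened D (mkseq (req x) t).
Let hits (t : nat) (x : X) := count (fun f : facility single_point => x (inord t) \in f.2) (G t x).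
Let weight (t : nat) (x : X) := (\sum_(f <- G t x) #|(f.2 : {set S})|)%N.

(** Unless its commodity is already on offer, request [t] forces a new facility. *)
Lemma miss_opens t x : (size (G t x) < size (G t.+1 x) + hits t x)%N.
Proof.
rewrite /hits /G mkseqS opened_rcons size_cat.
have := @opened_serves _ _ _ D (mkseq (req x) t) (req x t) (x (inord t)) (set11 _).
rewrite opened_rcons has_cat => /orP[|].
  rewrite has_count => c0.
  by rewrite -addnA -[ltnLHS]addn0 ltn_add2l addn_gt0 c0 orbT.
by case: (decide _ _ _).1 => //= f F _; rewrite -addnA addnS ltnS leq_addr.
Qed.

Lemma size_opened_hits x : (k.+1 <= size (G k.+1 x) + \sum_(t < k.+1) hits t x)%N.
Proof.
suff H t : (t <= size (G t x) + \sum_(i < t) hits i x)%N by exact: H.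
elim: t => // t IH; rewrite big_ord_recr /= addnA addnAC.
apply: leq_trans (leq_add (miss_opens t x) (leqnn _)).
by rewrite addSn ltnS.
Qed.

Lemma weight_le t x : (t <= k.+1)%N -> (weight t x <= weight k.+1 x)%N.
Proof.
move=> tk; rewrite /weight /G -(subnKC tk) /mkseq iotaD map_cat.
have [F ->] := opened_cat D (mkseq (req x) t)
  [seq req x i | i <- iota (0 + t) (k.+1 - t)].
by rewrite big_cat leq_addr.
Qed.

(* The facilities opened before the [t]-th request do not depend on [x t]. *)
Lemma sum_hits (t : 'I_k.+1) :
  ((\sum_x hits t x) * #|S| = \sum_x weight t x)%N.
Proof.
rewrite -(sum_resample t); apply: eq_bigr => x _.
have Gx a : G t (resample x t a) = G t x.
  have mkE (y : X) : mkseq (req y) t =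
      map singleton_request (mkseq (fun i => y (inord i)) t).
    by rewrite /mkseq -map_comp.
  rewrite /G !mkE; congr (opened _ (map _ _)); apply/eq_in_map => i.
  rewrite mem_iota add0n => /andP[_ it]; rewrite ffunE ifF//.
  apply/negbTE/eqP => /(congr1 val) /=.
  rewrite inordK ?(ltn_trans it)// => ti; by rewrite ti ltnn in it.
(* Summing over the resampled commodity counts each facility once per commodity it offers. *)
under eq_bigr => a _ do rewrite /hits Gx ffunE inord_val eqxx -sum1_count.
rewrite /weight; elim: (G t x) => [|f F IH].
  by rewrite big_nil big1// => a _; rewrite big_nil.
rewrite big_cons -IH -sum1_card [X in (X + _)%N]big_mkcond /= -big_split /=.
by apply: eq_bigr => a _; rewrite big_cons; case: ifP.
Qed.

(** The part of the opening costs that grows with the configurations pays for the hits: on average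
    [hits] total at most [weight / k.+1]. So construction costs on average at least [L] times
    facilities plus hits, of which there are at least [k.+1]. *)
Lemma sum_online_cost_commodity n :
  (L * k.+1%:R) *+ #|X| <= \sum_x online_cost D (commodity_requests n x).
Proof.
have cost_ge x : L * ((size (G k.+1 x))%:R + (weight k.+1 x)%:R / k.+1%:R) <=
    online_cost D (commodity_requests n x).
  apply: le_trans (online_cost_le_cat D _ _); apply: le_trans (online_cost_ge_opened _ _).
  rewrite -/(G _ _) /weight -sum1_size !natr_sum mulr_suml -big_split mulr_sumr.
  exact: ler_sum.
apply: (le_trans _ (ler_sum _ (fun x _ => cost_ge x))).
rewrite -mulr_sumr big_split -mulr_suml -!natr_sum /= -mulrnAr ler_pM2l//.
have H1 : (k.+1 * #|X| <= \sum_x size (G k.+1 x) + \sum_x \sum_(t < k.+1) hits t x)%N.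
  rewrite mulnC -sum_nat_const -big_split /=.
  by apply: leq_sum => x _; exact: size_opened_hits.
have H2 : ((\sum_x \sum_(t < k.+1) hits t x) * #|S| <= k.+1 * \sum_x weight k.+1 x)%N.
  rewrite exchange_big big_distrl /= -[X in (_ <= X * _)%N]card_ord -sum_nat_const.
  apply: leq_sum => t _; rewrite sum_hits; apply: leq_sum => x _.
  exact/weight_le/ltnW.
(* Bounding [|S|] below by [k.+1 ^ 2] in [H2] and cancelling one factor [k.+1]. *)
have H3 : (k.+1 * (\sum_x \sum_(t < k.+1) hits t x) <= \sum_x weight k.+1 x)%N.
  rewrite -(leq_pmul2l (ltn0Sn k)) mulnA mulnn; apply: leq_trans H2.
  by rewrite mulnC leq_mul2l kS orbT.
rewrite -mulrnA; move: H1; rewrite -(ler_nat R) natrD => /le_trans -> //.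
by rewrite lerD2l ler_pdivlMr ?ltr0n// -natrM ler_nat mulnC.
Qed.

End SinglePoint.

Lemma competitive_ge_sqrt (R : realType) (S : finType) (A : randomized_algorithm R S)
    (c : nat -> nat -> R) (k n : nat) :
  competitive (@line_metric R S) A c -> (k.+1 ^ 2 <= #|S|)%N -> (k < n)%N ->
  k.+1%:R <= Num.max (c #|S| n) 0 * 2.
Proof.
case=> a comp kS kn; apply: (@scaling_bound _ _ _ _ a) => L L0.
pose rs := @commodity_requests R S k L L0 n.
have sz x : size (rs x) = n by rewrite size_cat size_mkseq size_nseq subnKC.
apply: (@yao_bound _ _ A _ {ffun 'I_k.+1 -> S} rs n (c #|S| n) a (L * k.+1%:R) (L * 2)) => //.
- by rewrite card_ffun expn_gt0 (leq_trans _ kS)// expn_gt0.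
- exact: opt_commodity_requests.
- by move=> x; exact: opt_ge0.
- by move=> D; exact: sum_online_cost_commodity.
- by move=> x; rewrite -(sz x); apply: comp; exact: single_point_line.
Qed.

(** * The logarithm: random descent in a tree embedded in the line *)

Section Hierarchy.

Context {R : realType} {S : finType}.
Variables (h m : nat).
Hypotheses (S0 : (0 < #|S|)%N) (m2 : (2 < m)%N).

Let X := {ffun 'I_h -> bool}.

Let mR0 : 0 < m%:R :> R. Proof. by rewrite ltr0n (ltn_trans _ m2). Qed.
Let mR2 : 2 <= m%:R - 1 :> R.
Proof. by rewrite lerBrDr natr1 ler_nat. Qed.

Let mR1 : 0 < m%:R - 1 :> R. Proof. exact: lt_le_trans mR2. Qed.

Definition position (x : X) : R := \sum_(j < h) (x j)%:R * m%:R ^- j.+1.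

(** Only digits from [t] on contribute, and the geometric series of ratio [1 / m] dominates them. *)
Lemma digits_tail_le (z : 'I_h -> R) (t : nat) :
  (forall j, `|z j| <= 1) -> (forall j : 'I_h, (j < t)%N -> z j = 0) ->
  `|\sum_(j < h) z j * m%:R ^- j.+1| <= m%:R ^- t / (m%:R - 1).
Proof.
move=> z1 z0; apply: (le_trans (ler_norm_sum _ _ _)).
(* Partial sum plus remainder does not depend on [p]; [maxn] covers [p <= t]. *)
have tail p : \sum_(j < p | (t <= j)%N) m%:R ^- j.+1
    + m%:R ^- (maxn t p) / (m%:R - 1) = m%:R ^- t / (m%:R - 1) :> R.
  elim: p => [|p IH]; first by rewrite big_ord0 add0r maxn0.
  rewrite big_mkcond big_ord_recr -big_mkcond /= -[RHS]IH -addrA; congr (_ + _).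
  case: leqP => tp.
    rewrite (maxn_idPr (leqW tp)) exprS.
    rewrite [m%:R * _]mulrC; field; by rewrite !gt_eqF ?exprn_gt0.
  by rewrite add0r (maxn_idPl tp).
rewrite -(tail h); apply: ler_wpDr.
  by rewrite divr_ge0 ?invr_ge0 ?exprn_ge0 ?(ltW mR0) ?(ltW mR1).
rewrite [leRHS]big_mkcond; apply: ler_sum => j _.
have mj : 0 <= m%:R ^- j.+1 :> R by rewrite invr_ge0 exprn_ge0// ltW.
case: leqP => tj; last by rewrite z0// mul0r normr0.
by rewrite normrM [X in _ * X]ger0_norm// ler_piMl.
Qed.

Lemma positionB x y :
  position x - position y = \sum_(j < h) ((x j)%:R - (y j)%:R) * m%:R ^- j.+1.
Proof. by rewrite -sumrB; apply: eq_bigr => j _; rewrite mulrBl. Qed.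

Lemma normrB_bool (a b : bool) : `|a%:R - b%:R| = (a != b)%:R :> R.
Proof. by case: a b => -[] /=; rewrite ?subrr ?subr0 ?sub0r ?normrN ?normr0 ?normr1. Qed.

(** The first differing digit [i] contributes [m ^- i.+1]; the later ones cancel at most the
    fraction [1 / (m - 1)] of it, which is at most half since [m > 2]. *)
Lemma position_far (x y : X) (j : 'I_h) : x j != y j ->
  m%:R ^- j.+1 / 2 <= `|position x - position y|.
Proof.
move=> xyj.
case: (@arg_minnP _ j (fun i => x i != y i) val xyj) => i xyi min_i.
rewrite positionB (bigD1 i)//=.
set T := \sum_(_ < h | _) _.
have TE : T = \sum_(l < h) (if l == i then 0 else (x l)%:R - (y l)%:R) * m%:R ^- l.+1.
  rewrite [RHS](bigD1 i)//= eqxx mul0r add0r.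
  by apply: eq_bigr => l /negbTE ->.
have T1 : `|T| <= m%:R ^- i.+1 / (m%:R - 1).
  rewrite TE; apply: digits_tail_le => l.
    by case: eqP => _; rewrite ?normr0// normrB_bool; case: (_ != _).
  rewrite ltnS leq_eqVlt => /orP[/eqP li|li]; first by rewrite ifT//; apply/eqP/val_inj.
  case: ifP => // _; case: (eqVneq (x l) (y l)) => [->|/min_i]; first by rewrite subrr.
  by rewrite leqNgt li.
have mi : 0 < m%:R ^- i.+1 :> R by rewrite invr_gt0 exprn_gt0.
have T2 : m%:R ^- i.+1 / (m%:R - 1) <= m%:R ^- i.+1 / 2 :> R.
  by rewrite ler_pM2l// lef_pV2 ?posrE.
have ij : m%:R ^- j.+1 <= m%:R ^- i.+1 :> R.
  rewrite lef_pV2 ?posrE ?exprn_gt0// ler_weXn2l//; last exact: min_i.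
  by rewrite ler1n ltnW// ltnW.
set u := (X in X + T).
have u1 : `|u| = m%:R ^- i.+1.
  by rewrite normrM normrB_bool xyi mul1r ger0_norm// ltW.
have := ler_normB (u + T) T; rewrite addrK u1.
move: mi T1 T2 ij; set v := _ ^- i.+1; set w := _ ^- j.+1; lra.
Qed.

Lemma position_inj : injective position.
Proof.
move=> x y xy; apply/ffunP => j; apply/eqP/negPn/negP => /position_far.
by rewrite xy subrr normr0 leNgt divr_gt0// invr_gt0 exprn_gt0.
Qed.

Variables (L : R) (L0 : 0 < L).

Definition tree_dist (x y : X) : R := L * `|position x - position y|.

Lemma tree_dist_ge0 x y : 0 <= tree_dist x y.
Proof. by rewrite mulr_ge0// ltW. Qed.

Lemma tree_dist_eq0 x y : tree_dist x y = 0 <-> x = y.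
Proof.
split=> [/eqP|->]; last by rewrite /tree_dist subrr normr0 mulr0.
by rewrite mulf_eq0 gt_eqF//= normr_eq0 subr_eq0 => /eqP/position_inj.
Qed.

Lemma tree_dist_sym x y : tree_dist x y = tree_dist y x.
Proof. by rewrite /tree_dist distrC. Qed.

Lemma tree_dist_triangle x y z : tree_dist x z <= tree_dist x y + tree_dist y z.
Proof. by rewrite /tree_dist -mulrDr ler_pM2l// ler_distD. Qed.

Lemma const_cost_subadditive (_ : X) (a b : {set S}) : L <= L + L.
Proof. by rewrite lerDl ltW. Qed.

Lemma const_cost_per_commodity (_ : X) (s : {set S}) : s != finset.set0 ->
  L / #|S|%:R <= L / #|s|%:R.
Proof.
rewrite -card_gt0 => s0; rewrite ler_pM2l// lef_pV2 ?posrE ?ltr0n//.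
by rewrite ler_nat max_card.
Qed.

Definition tree : setting R S :=
  @Setting R S X tree_dist (fun _ _ => L) tree_dist_ge0 tree_dist_eq0
    tree_dist_sym tree_dist_triangle (fun _ _ => ltW L0)
    const_cost_subadditive const_cost_per_commodity.

Lemma tree_line : line_metric tree.
Proof.
exists (fun x => L * position x) => x y.
by rewrite -mulrBr normrM gtr0_norm.
Qed.

(* A node of level [t] is represented by the leaf obtained by completing its
   path with zeros; [cut t x] is the ancestor of [x] at level [t], and
   [agree t x y] says that [y] lies below it. *)
Definition cut (t : nat) (x : X) : X := [ffun j : 'I_h => (j < t)%N && x j].

Definition agree (t : nat) (x y : X) := [forall j : 'I_h, (j < t)%N ==> (y j == x j)].

Lemma dist_cut_le t x : tree_dist x (cut t x) <= L * (m%:R ^- t / (m%:R - 1)).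
Proof.
rewrite ler_pM2l// positionB; apply: digits_tail_le => j.
  by rewrite normrB_bool; case: (_ != _).
by rewrite ffunE => -> /=; rewrite subrr.
Qed.

Lemma dist_cut_ge t x y : ~~ agree t x y ->
  L * (m%:R ^- t / 2) <= tree_dist y (cut t x).
Proof.
rewrite negb_forall => /existsP[j]; rewrite negb_imply => /andP[jt yx].
have yxj : y j != cut t x j by rewrite ffunE jt.
rewrite ler_pM2l//; apply: le_trans (position_far yxj).
rewrite ler_pM2r ?invr_gt0// lef_pV2 ?posrE ?exprn_gt0// ler_weXn2l//.
by rewrite ler1n ltnW// ltnW.
Qed.

Lemma setT_neq0 : [set: S]%SET != finset.set0.
Proof. by rewrite -card_gt0 cardsT. Qed.

Definition full_request (x : X) : request tree := @Request R S tree x [set: S]%SET setT_neq0.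

(** Levels 0 to [t - 1] are visited, so [descent t.+1 x] depends only on the digits below [t]. The
    multiplicity [m ^ t'] compensates distances of order [m ^- t']. *)
Fixpoint descent (t : nat) (x : X) : seq (request tree) :=
  if t is t'.+1 then descent t' x ++ nseq (m ^ t') (full_request (cut t' x))
  else [::].

Lemma size_descent t x : (size (descent t x) < m ^ t)%N.
Proof.
elim: t => [|t IH] //=; rewrite size_cat size_nseq expnS.
apply: leq_trans (_ : 2 * m ^ t <= _)%N; last by rewrite leq_mul2r (ltnW m2) orbT.
by rewrite mul2n -addnn -addSn leq_add2r.
Qed.

(** The padding sits at the leaf [x], where the offline facility stands, so it costs the optimum
    nothing. *)
Definition descent_requests (n : nat) (x : X) :=
  descent h x ++ nseq (n - size (descent h x)) (full_request x).

(** From a facility at the leaf, each level costs at most [m ^ t] times [L * m ^- t / (m - 1)], that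
    is [L / (m - 1)]. *)
Lemma opt_descent_requests n x :
  opt (descent_requests n x) <= L * (1 + h%:R / (m%:R - 1)).
Proof.
apply: (le_trans (@opt_le_single _ _ tree (x, [set: S]%SET) _ _)).
  by apply/(all_nthP (full_request x)) => i _; exact: finset.subsetT.
rewrite /= mulrDr mulr1 lerD2l big_cat /= -[leRHS]addr0 lerD//; last first.
  by rewrite big_nseq iter_addr addr0 /tree_dist subrr normr0 mulr0 mul0rn.
elim: (h) => [|t IH] /=; first by rewrite big_nil mul0r mulr0.
rewrite big_cat /= -[t.+1]addn1 natrD mulrDl mulrDr lerD//.
rewrite big_nseq iter_addr addr0 mul1r.
apply: le_trans (_ : (L * (m%:R ^- t / (m%:R - 1))) *+ (m ^ t) <= _).
  by rewrite lerMn2r dist_cut_le orbT.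
by rewrite -mulr_natr natrX -mulrA mulrAC mulVf ?mul1r// expf_neq0// gt_eqF.
Qed.

Variable D : online_algorithm R S.

Let G (t : nat) (x : X) := opened D (descent t x).
Let agreeing (t : nat) (x : X) (F : seq (facility tree)) :=
  count (fun f : facility tree => agree t x f.1) F.
 
(** If no facility, even one opened during the phase, lies below the current node, each of the
    [m ^ t] requests pays at least [L * m ^- t / 2]. Otherwise the last summand is at most 0 and
    construction costs suffice. *)
Lemma phase_cost t x :
  online_cost D (descent t x) + L * (size (G t.+1 x))%:R - L * (size (G t x))%:R
    + L / 2 * (1 - (agreeing t x (G t.+1 x))%:R)
  <= online_cost D (descent t.+1 x).
Proof.
have sumL (F : seq (facility tree)) : \sum_(f <- F) cost f.1 f.2 = L * (size F)%:R.
  by rewrite big_const_seq count_predT iter_addr addr0 mulr_natr.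
have [no|some] := posnP (agreeing t x (G t.+1 x)).
  rewrite no subr0 mulr1 -!sumL.
  have -> : L / 2 = (L * (m%:R ^- t / 2)) *+ (m ^ t).
    rewrite -[RHS]mulr_natr natrX -mulrA; congr (L * _).
    by rewrite mulrAC mulVf ?mul1r// expf_neq0// gt_eqF.
  apply: online_cost_nseq => [|f fG].
    by rewrite !mulr_ge0 ?invr_ge0 ?exprn_ge0 ?(ltW L0) ?(ltW mR0).
  apply: dist_cut_ge; apply/negP => af.
  by have /hasPn/(_ f fG) : ~~ has (fun f : facility tree => agree t x f.1) (G t.+1 x);
    [rewrite has_count -/(agreeing _ _ _) no|rewrite af].
apply: le_trans (_ : online_cost D (descent t x) + L * (size (G t.+1 x))%:R
    - L * (size (G t x))%:R <= _); last by rewrite -!sumL; exact: online_cost_cat.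
rewrite gerDl mulr_ge0_le0//; first by rewrite divr_ge0// ltW.
by rewrite subr_le0 ler1n.
Qed.

Lemma online_cost_descent t x :
  L * (size (G t x))%:R + L / 2 * (t%:R - (\sum_(i < t) agreeing i x (G i.+1 x))%:R)
  <= online_cost D (descent t x).
Proof.
elim: t => [|t IH].
  by rewrite big_ord0 subrr mulr0 mulr0 addr0; exact: total_cost_ge0.
apply: le_trans (phase_cost t x); rewrite big_ord_recr /= -[t.+1]addn1 !natrD.
have : L / 2 + (L / 2) = L by rewrite -splitr.
by move: IH; lra.
Qed.

Lemma agreeing_split t x : exists F, G t.+1 x = G t x ++ F.
Proof. exact: opened_cat. Qed.

(* The facilities opened up to level [t] do not depend on the turn taken after
   level [t], so resampling that turn halves their expected number below. *)
Lemma sum_agreeing_next (t : 'I_h) :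
  (2 * \sum_x agreeing t.+1 x (G t.+1 x) = \sum_x agreeing t x (G t.+1 x))%N.
Proof.
rewrite mulnC -card_bool -(sum_resample t); apply: eq_bigr => x _.
have cutr b i : (i <= t)%N -> cut i (resample x t b) = cut i x.
  move=> it; apply/ffunP => j; rewrite !ffunE.
  by case: eqP => // ->; rewrite ltnNge it.
have Gr b : G t.+1 (resample x t b) = G t.+1 x.
  rewrite /G; congr opened; move: (ltnSn t); move: {1 3 4}(t.+1) => i.
  elim: i => //= i IH it; rewrite IH ?cutr//; exact: ltnW.
(* A facility below the node of level [t] stays below the next node for exactly one of the two turns
   [b]. *)
have agr b y : agree t.+1 (resample x t b) y = (y t == b) && agree t x y.
  apply/forallP/andP => [H|[/eqP yb /forallP H] j].
    split; first by have := H t; rewrite ltnS leqnn ffunE eqxx.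
    apply/forallP => j; apply/implyP => jt; have := H j; rewrite ltnS (ltnW jt) ffunE.
    by rewrite ifF//; apply/negbTE/eqP => jE; rewrite jE ltnn in jt.
  rewrite ffunE; case: (eqVneq j t) => [->|jt]; first by rewrite yb eqxx implybT.
  by rewrite ltnS leq_eqVlt (negbTE (jt : val j != val t)); exact: H.
rewrite big_bool /= !Gr /agreeing; elim: (G t.+1 x) => //= f F IH.
by rewrite !agr addnACA IH; case: (f.1 t) => /=; case: agree.
Qed.

(** The second term is a potential. Each new facility agrees at most once when opened and survives
    each turn with probability 1/2, so it spares at most [1 + 1/2 + 1/4 + ... = 2] levels on
    average. *)
Lemma sum_agreeing_le t : (t <= h)%N ->
  (\sum_(i < t) \sum_x agreeing i x (G i.+1 x) + 2 * \sum_x agreeing t x (G t x)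
    <= 2 * \sum_x size (G t x))%N.
Proof.
elim: t => [|t IH] th.
  by rewrite big_ord0 !big1.
rewrite big_ord_recr /= -[t in agreeing t.+1]/(val (Ordinal th)) sum_agreeing_next /=.
have step : (\sum_x agreeing t x (G t.+1 x) + \sum_x size (G t x)
    <= \sum_x agreeing t x (G t x) + \sum_x size (G t.+1 x))%N.
  rewrite -!big_split /=; apply: leq_sum => x _; have [F ->] := agreeing_split t x.
  rewrite /agreeing count_cat size_cat -addnA leq_add2l addnC leq_add2l.
  exact: count_size.
have := IH (ltnW th); move: step.
set a := (\sum_x agreeing t x (G t.+1 x))%N; set b := (\sum_x size (G t x))%N.
set c := (\sum_x agreeing t x (G t x))%N; set d := (\sum_x size (G t.+1 x))%N.
set e := (\sum_(i < t) _)%N; lia.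
Qed.

(** A facility costs [L] and spares on average at most two levels worth [L / 2] each, so opening
    facilities never beats the baseline [L * h / 2]. *)
Lemma sum_online_cost_descent n :
  (L * (h%:R / 2)) *+ #|{: X}| <= \sum_x online_cost D (descent_requests n x).
Proof.
apply: le_trans (ler_sum _ (fun x _ => online_cost_le_cat D (descent h x) _)).
apply: le_trans (ler_sum _ (fun x _ => online_cost_descent h x)).
rewrite big_split -!mulr_sumr sumrB -!natr_sum sumr_const /=.
have := leq_trans (leq_addr _ _) (sum_agreeing_le (leqnn h)).
rewrite exchange_big -(ler_nat R) natrM.
set a := (\sum_x size _)%:R; set b := (\sum_x _)%:R => ab.
have : 0 <= L * (2 * a - b) by rewrite mulr_ge0 ?(ltW L0)// subr_ge0.
rewrite -mulrnAr -mulrnAl; lra.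
Qed.

End Hierarchy.
Lemma competitive_ge_depth (R : realType) (S : finType) (A : randomized_algorithm R S)
    (c : nat -> nat -> R) (h n : nat) :
  competitive (@line_metric R S) A c -> (0 < #|S|)%N -> (1 < h)%N ->
  (h.+1 ^ h <= n)%N -> h%:R / 2 <= Num.max (c #|S| n) 0 * 2.
Proof.
case=> a comp S0 h1 hn; apply: (@scaling_bound _ _ _ _ a) => L L0.
have m2 : (2 < h.+1)%N by [].
pose rs := @descent_requests R S h h.+1 S0 m2 L L0 n.
have sz x : size (rs x) = n.
  rewrite size_cat size_nseq subnKC//.
  exact: leq_trans (ltnW (size_descent _ _ _ _ _)) hn.
apply: (@yao_bound _ _ A _ {ffun 'I_h -> bool} rs n (c #|S| n) a _ (L * 2)) => //.
- by rewrite card_ffun expn_gt0 card_bool.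
- move=> x; apply: (le_trans (opt_descent_requests _ _ _ _ _)).
  (* For [m = h.+1], the factor [1 + h / (m - 1)] is 2. *)
  rewrite ler_pM2l// -natr1 addrK divff//.
  by rewrite pnatr_eq0 -lt0n ltnW.
- by move=> x; exact: opt_ge0.
- by move=> D; exact: sum_online_cost_descent.
- by move=> x; rewrite -[X in c _ X](sz x); apply: comp; exact: tree_line.
Qed.

(** * Choice of the parameters and conclusion *)

Lemma expn_le_of_log_ratio (R : realType) (n : nat) (h : nat) :
  0 < ln n%:R :> R -> 1 <= ln (ln n%:R) :> R ->
  h.+1%:R <= ln n%:R / ln (ln n%:R) :> R -> (h.+1 ^ h <= n)%N.
Proof.
move=> u0 lu1; set u := ln n%:R; set v := ln u => hr.
have v0 : 0 < v by exact: lt_le_trans lu1.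
have n0 : (0 < n)%N by case: n u0 {u v v0 hr lu1} => //; rewrite ln0 ?ltxx.
rewrite -(ler_nat R) natrX -ler_ln ?posrE ?exprn_gt0 ?ltr0n//.
rewrite lnXn ?ltr0n// -/u.
(* From [h.+1 <= u / v <= u] follows [ln h.+1 <= v]; multiplying by [h <= u / v] gives
   [h * ln h.+1 <= u]. *)
have hu : ln h.+1%:R <= v :> R.
  rewrite ler_ln ?posrE ?ltr0n//; apply: (le_trans hr).
  by rewrite ler_pdivrMr// ler_peMr// ltW.
rewrite -[u](divfK (lt0r_neq0 v0)) -[leLHS]mulr_natl.
apply: ler_pM => //; first by rewrite ln_ge0// ler1n.
by apply: le_trans hr; rewrite ler_nat.
Qed.

(** With [ln u = 2 * ln (sqrt u) <= 2 * sqrt u] and [sqrt u >= 6], one gets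
    [3 * ln u <= 6 * sqrt u <= u]. This will make the depth [h] at least 2. *)
Lemma div_ln_ge3 (R : realType) (u : R) : 36 <= u -> 1 <= ln u -> 3 <= u / ln u.
Proof.
move=> u36 lu; have u0 : 0 < u by lra.
have s6 : 6 <= Num.sqrt u.
  by rewrite (_ : 6 = Num.sqrt (6 ^+ 2)) ?ler_wsqrtr ?sqrtr_sqr ?ger0_norm//; lra.
have us : u = Num.sqrt u ^+ 2 by rewrite sqr_sqrtr// ltW.
have ls : ln u <= 2 * Num.sqrt u.
  rewrite {1}us lnXn ?sqrtr_gt0// -[leLHS]mulr_natl ler_pM2l//.
  by apply: ltW; apply: ln_sublinear; rewrite sqrtr_gt0.
rewrite ler_pdivlMr ?(lt_le_trans _ lu)//.
have : 6 * Num.sqrt u <= u by rewrite {2}us expr2 ler_pM2r// sqrtr_gt0.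
lra.
Qed.

Theorem corollary3 (R : realType) :
  exists kappa : R, 0 < kappa /\
  forall S : finType, (0 < #|S|)%N ->
  forall (A : randomized_algorithm R S) (c : nat -> nat -> R),
    competitive (@line_metric R S) A c ->
    exists N : nat, forall n : nat, (N <= n)%N ->
      kappa * (Num.sqrt #|S|%:R + ln n%:R / ln (ln n%:R)) <= c #|S| n.
Proof.
(* The two bounds give [sqrt |S| < k + 2 <= 2 * k.+1 <= 4 * c] and, as [h >= 2],
   [r < h + 2 <= 2 * h <= 8 * c]; the sum is at most [12 * c]. *)
exists (1 / 12); split; first by lra.
move=> S S0 A c comp.
(* Having [n >= |S|] leaves room for [k.+1] requests; the exponential gives [ln n >= 36 + e], whence
   [ln (ln n) >= 1] and [div_ln_ge3] applies. *)
exists (maxn #|S| (Num.truncn (expR (36 + expR 1) : R)).+1) => n.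
rewrite geq_max => /andP[nS nN].
pose u : R := ln n%:R; pose r := u / ln u.
have nR : expR (36 + expR 1) <= n%:R :> R.
  by apply: le_trans (ltW (truncnS_gt _)) _; rewrite ler_nat.
have n0 : 0 < n%:R :> R by apply: lt_le_trans nR; exact: expR_gt0.
have uN : 36 + expR 1 <= u by rewrite -[leLHS]expRK ler_ln ?posrE ?expR_gt0.
have e0 := expR_gt0 (1 : R).
have lu : 1 <= ln u by rewrite -[leLHS]expRK ler_ln ?posrE//; lra.
have r3 : 3 <= r by apply: div_ln_ge3 => //; lra.
have [h hE] : exists h, Num.truncn r = h.+1.
  by case: (Num.truncn r) (truncnS_gt r) => [|h _]; [lra|exists h].
have r0 : 0 <= r by lra.
have hr : h.+1%:R <= r by rewrite -hE truncn_le.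
have rh : r < h.+2%:R by rewrite -hE truncnS_gt.
have h1 : (1 < h)%N by rewrite -2!ltnS -(ltr_nat R); lra.
have hn : (h.+1 ^ h <= n)%N by apply: (@expn_le_of_log_ratio R) => //; rewrite -/u; lra.
have s1 : 1 <= Num.sqrt #|S|%:R :> R by rewrite -[leLHS]sqrtr1 ler_wsqrtr// ler1n.
set s := Num.sqrt _ in s1 *.
have [k kE] : exists k, Num.truncn s = k.+1.
  by case: (Num.truncn s) (truncnS_gt s) => [|k _]; [lra|exists k].
have s0 : 0 <= s by lra.
have ks : k.+1%:R <= s by rewrite -kE truncn_le.
have sk : s < k.+2%:R by rewrite -kE truncnS_gt.
have kS : (k.+1 ^ 2 <= #|S|)%N.
  rewrite -(ler_nat R) natrX -[leRHS]sqr_sqrtr// -/s.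
  by rewrite ler_pXn2r// nnegrE.
have kn : (k < n)%N by apply: leq_trans nS; apply: leq_trans kS; rewrite -{1}[k.+1]expn1 leq_pexp2l.
have := competitive_ge_sqrt comp kS kn.
have := competitive_ge_depth comp S0 h1 hn.
have : 2 <= h%:R :> R by rewrite ler_nat.
have k0 : 0 <= k%:R :> R by [].
(* A nonpositive ratio would force [h / 2 <= 0], against [h >= 2]. *)
rewrite -/u -/r; case: (leP (c #|S| n) 0) => _; first lra.
move: rh sk; rewrite -[h.+2]addn2 -[k.+2]addn2 -[k.+1]addn1 !natrD; lra.
Qed.
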